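(* Consider the nonlinear time-periodic problem $\mathbf u'(t)=\mathbf f(\mathbf u(t),t)$, $t\in[0,T]$, $\mathbf u(0)=\mathbf u(T)$, with fine and coarse propagators $\mathcal F_n,\mathcal G_n$ ($0\le n<N$) and fine periodic reference $\mathbf u^\star=(\mathbf u_0^\star,\ldots,\mathbf u_{N-1}^\star)$. Fix an iteration index $k$, interface values $\mathbf U^k\in(\mathbb R^d)^N$ and an orthogonal projection $P:\mathbb R^d\to\mathbb R^d$ with complement $Q:=I-P$. Let $\mathbf U^{k+1}\in(\mathbb R^d)^N$ be given by the projection-based PP-PC update using the discrepancy-form propagator with $P^k=P$, that is, $$\mathbf U_{n+1}^{k+1}=\mathcal F_n(\mathbf U_n^k)+\mathcal H_{P,n}(\mathbf U_n^{k+1})-\mathcal H_{P,n}(\mathbf U_n^k),\qquad n=0,\ldots,N-1,\qquad \mathbf U_N^{k+1}=\mathbf U_0^{k+1}.$$ Suppose that the following three assumptions hold. (1) Local nonlinear region: there is a convex set $\mathcal B_k\subset\mathbb R^d$ such that for all $n=0,\ldots,N-1$ and $s\in[0,1]$, $\mathbf U_n^k+s\mathbf e_n^k\in\mathcal B_k$, $P(\mathbf U_n^k+s\mathbf e_n^k)\in\mathcal B_k$, and $\mathbf u_n^\star,\mathbf U_n^{k+1}\in\mathcal B_k$; and each $\mathcal H_{P,n}$ is well defined on $\mathcal B_k$. (2) Local nondegeneracy: each $\mathcal H_{P,n}$ is continuously differentiable on an open neighborhood of $\mathcal B_k$, and $1$ is not an eigenvalue of $\widehat M_P:=\mathrm D\mathcal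 H_{P,N-1}(\mathbf u_{N-1}^\star)\cdots\mathrm D\mathcal H_{P,0}(\mathbf u_0^\star)$; equivalently, the linearized cyclic operator $\widehat{\mathcal C}_P$ is invertible. Set $\widehat\Gamma_k:=\|\widehat{\mathcal C}_P^{-1}\|_{\infty\to\infty}$. (3) Local smoothness: each $\mathcal D_n=\mathcal F_n-\mathcal G_n$ is continuously Fréchet differentiable on an open neighborhood of $\mathcal B_k$, and there are constants $\mu_k,\nu_k,\kappa_k\ge 0$ such that for all $\mathbf x,\mathbf y\in\mathcal B_k$ and $n=0,\ldots,N-1$, $$\|\mathrm D\mathcal D_n(\mathbf x)\|_2\le\mu_k,\qquad \|\mathrm D\mathcal D_n(\mathbf x)-\mathrm D\mathcal D_n(\mathbf y)\|_2\le\nu_k\|\mathbf x-\mathbf y\|_2,$$ $$\|\mathrm D\mathcal H_{P,n}(\mathbf x)-\mathrm D\mathcal H_{P,n}(\mathbf y)\|_2\le\kappa_k\|\mathbf x-\mathbf y\|_2 .$$ Assume also that, for some $R>0$, the update $\mathbf U^{k+1}$ satisfies $E_\infty^{k+1}\le R$ and the smallness condition $\tfrac12\widehat\Gamma_k\kappa_kR<1$ holds. If $E_\infty^k=0$, then $E_\infty^{k+1}=0$. If $E_\infty^k>0$, then $$E_\infty^{k+1}\le\rho_k(P)\,E_\infty^k,$$ where $$\rho_k(P):=\frac{\widehat\Gamma_k}{1-\tfrac12\widehat\Gamma_k\kappa_kR}\left[\mu_k\theta_Q^k(P)+\nu_kU_k^\perp(P)\theta_P^k(P)+\frac{\nu_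k}{2}\theta_Q^k(P)\theta_P^k(P)E_\infty^k\right].$$
   Context: Setting. $T>0$, $N$ is a positive integer, $\Delta T=T/N$, $T_n=n\Delta T$. The function $\mathbf f$ is $T$-periodic in $t$ for all states in a domain containing the states considered, and $\mathbf f$ and its state Jacobian $\mathrm D_{\mathbf u}\mathbf f$ are continuous in $(\mathbf u,t)$. For $0\le n<N$, the fine propagator $\mathcal F_n$ and the coarse propagator $\mathcal G_n$ are maps on the state space $\mathbb R^d$; $\mathcal F_n(\mathbf x)$ (resp. $\mathcal G_n(\mathbf x)$) is an accurate (resp. less accurate but cheaper) approximation at time $T_{n+1}$ of the solution of the evolution problem starting from $\mathbf x$ at time $T_n$. $\mathrm D$ denotes the Jacobian with respect to the state, and $I$ is the identity on $\mathbb R^d$. Histories are elements $\mathbf w=(\mathbf w_0,\ldots,\mathbf w_{N-1})\in(\mathbb R^d)^N$; history indices are taken modulo $N$ (so $\mathbf w_N=\mathbf w_0$). Norms: $\|\mathbf w\|_\infty:=\max_{0\le n<N}\|\mathbf w_n\|_2$, and $\|S\|_{\infty\to\infty}:=\sup_{\mathbf w\ne 0}\|S\mathbf w\|_\infty/\|\mathbf w\|_\infty$ for linear operators $S$ on histories; $\|\cdot\|_2$ on matrices is the spectral norm. Fine--coarse discrepancy: $\mathcal D_n(\mathbf x):=\mathcal F_n(\mathbf x)-\mathcal G_n(\mathbf x)$. Discrepancy-form propagator for an orthogonal projection $P$: $\mathcal H_{P,n}(\mathbf x):=\mathcal G_n(\mathbf x)+\mathcal D_n(P\mathbf x)$. Fine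 periodic reference: $\mathbf u^\star=(\mathbf u_0^\star,\ldots,\mathbf u_{N-1}^\star)\in(\mathbb R^d)^N$ satisfying $\mathbf u_{n+1}^\star=\mathcal F_n(\mathbf u_n^\star)$ for $n=0,\ldots,N-1$, with $\mathbf u_N^\star=\mathbf u_0^\star$; its existence is assumed. Errors: $\mathbf e_n^j:=\mathbf u_n^\star-\mathbf U_n^j$ and $E_\infty^j:=\max_{0\le n<N}\|\mathbf e_n^j\|_2$ for $j\in\{k,k+1\}$. Linearized cyclic operator: the linear operator $\widehat{\mathcal C}_P$ on $(\mathbb R^d)^N$ given by $(\widehat{\mathcal C}_P\mathbf w)_{n+1}:=\mathbf w_{n+1}-\mathrm D\mathcal H_{P,n}(\mathbf u_n^\star)\mathbf w_n$, $n=0,\ldots,N-1$, indices modulo $N$. Ratios and weight (for $E_\infty^k>0$): $\theta_Q^k(P):=\max_{0\le n<N}\|Q\mathbf e_n^k\|_2/E_\infty^k$, $\theta_P^k(P):=\max_{0\le n<N}\|P\mathbf e_n^k\|_2/E_\infty^k$, and $U_k^\perp(P):=\max_{0\le n<N}\|Q\mathbf U_n^k\|_2$. *)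

(* Defs.v *)
From HB Require Import structures.
From mathcomp Require Export all_boot all_order all_algebra.
From mathcomp Require Export all_classical all_reals all_analysis.

Set Implicit Arguments.
Unset Strict Implicit.
Unset Printing Implicit Defensive.

Export Order.TTheory GRing.Theory Num.Theory numFieldNormedType.Exports.

Local Open Scope classical_set_scope.
Local Open Scope ring_scope.

(* Vectors of R^d are row vectors, as in the library's ['J f x], and matrices
   act on the right: the linear map [w |-> A w] of the usual column convention
   is [w |-> w *m A], and composites of maps are products in reverse order. *)

(* The canonical norm [`|x|] on ['rV[R]_d] is the sup norm, hence this one.
   Topology and differentiability do not depend on the choice. *)
Definition norm2 (R : realType) (d : nat) (x : 'rV[R]_d) : R :=
  Num.sqrt (\sum_(i < d) x ord0 i ^+ 2).

Definition spectral_norm (R : realType) (d : nat) (A : 'M[R]_d) : R :=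
  sup [set norm2 (w *m A) / norm2 w | w in [set w : 'rV[R]_d | w != 0]].

Definition orth_proj (R : realType) (d : nat) (P : 'M[R]_d) : Prop :=
  P *m P = P /\ P^T = P.

(* Indices modulo N: the successor of n is [ordS n], its predecessor
   [ord_pred n]. *)
Notation history R N d := ({ffun 'I_N -> 'rV[R]_d}).

(* All the terms are nonnegative, so that for N > 0 this is the maximum. *)
Definition norm_inf (R : realType) (N d : nat) (w : history R N d) : R :=
  \big[Num.max/0]_(n < N) norm2 (w n).

Definition opnorm_inf (R : realType) (N d : nat) (S : 'End(history R N d)) : R :=
  sup [set norm_inf (S w) / norm_inf w | w in [set w : history R N d | w != 0]].

Definition act_hist (R : realType) (N d : nat) (A : 'M[R]_d) (w : history R N d) :
    history R N d :=
  [ffun n => w n *m A].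

Definition C1_near (R : realType) (d : nat) (B : set 'rV[R]_d)
    (h : 'rV[R]_d -> 'rV[R]_d) : Prop :=
  exists O : set 'rV[R]_d,
    [/\ open O, B `<=` O, forall x, O x -> differentiable h x
      & forall x, O x -> {for x, continuous (fun y => 'J h y)}].

(* Standing assumptions on the right-hand side of u' = f(u, t). *)
Definition periodic_rhs (R : realType) (d : nat) (T : R) (Omega : set 'rV[R]_d)
    (f : 'rV[R]_d -> R -> 'rV[R]_d) : Prop :=
  [/\ forall u t, Omega u -> f u (t + T) = f u t,
      forall u t, Omega u ->
        {for (u, t), continuous (fun p : 'rV[R]_d * R => f p.1 p.2)},
      forall u t, Omega u -> differentiable (f ^~ t) u
    & forall u t, Omega u ->
        {for (u, t), continuous (fun p : 'rV[R]_d * R => 'J (f ^~ p.2) p.1)}].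

Section Propagators.
Variables (R : realType) (N d : nat).
Implicit Types (F G : 'I_N -> 'rV[R]_d -> 'rV[R]_d) (P : 'M[R]_d).

Definition discrepancy F G (n : 'I_N) (x : 'rV[R]_d) : 'rV[R]_d :=
  F n x - G n x.

Definition Hprop F G P (n : 'I_N) (x : 'rV[R]_d) : 'rV[R]_d :=
  G n x + discrepancy F G n (x *m P).

Definition fine_periodic F (u : history R N d) : Prop :=
  forall n, u (ordS n) = F n (u n).

Definition PP_PC_update F G P (U V : history R N d) : Prop :=
  forall n, V (ordS n) = F n (U n) + Hprop F G P n (V n) - Hprop F G P n (U n).

(* In row convention: DH_{N-1}(u_{N-1}) ... DH_0(u_0). *)
Definition monodromy F G P (u : history R N d) : 'M[R]_d :=
  \big[mulmx/1%:M]_(n < N) 'J (Hprop F G P n) (u n).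

(* The component of index m = n + 1 is w_{n+1} - DH_n(u_n) w_n. *)
Definition cyclic_fun F G P (u w : history R N d) : history R N d :=
  [ffun m => w m - w (ord_pred m) *m
     'J (Hprop F G P (ord_pred m)) (u (ord_pred m))].

Definition cyclic_op F G P (u : history R N d) : 'End(history R N d) :=
  linfun (cyclic_fun F G P u).

Fact cyclic_fun_linear F G P u : linear (cyclic_fun F G P u).
Proof.
move=> a v w; apply/ffunP=> m; rewrite !ffunE mulmxDl -scalemxAl scalerBr.
by rewrite opprD addrACA.
Qed.

Lemma cyclic_opE F G P u w n :
  cyclic_op F G P u w (ordS n) =
  w (ordS n) - w n *m 'J (Hprop F G P n) (u n).
Proof.
pose L := HB.pack (cyclic_fun F G P u)
  (GRing.isLinear.Build _ _ _ _ _ (cyclic_fun_linear F G P u)) :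
  {linear history R N d -> history R N d}.
have -> : cyclic_op F G P u w = cyclic_fun F G P u w by exact: (lfunE L).
by rewrite ffunE ordSK.
Qed.

(* [_^-1%VF] is the two-sided inverse as soon as the operator is bijective,
   i.e. as soon as 1 is not an eigenvalue of the monodromy matrix. *)
Definition Gamma_hat F G P (u : history R N d) : R :=
  opnorm_inf (cyclic_op F G P u)^-1%VF.

(* theta A e is theta_A, for e the error history and A = Q or P. *)
Definition theta (A : 'M[R]_d) (e : history R N d) : R :=
  norm_inf (act_hist A e) / norm_inf e.

Definition contraction_rho (Gamma mu nu kappa rad : R) P
    (U e : history R N d) : R :=
  let Q := 1%:M - P in
  Gamma / (1 - 2^-1 * Gamma * kappa * rad) *
  (mu * theta Q e + nu * norm_inf (act_hist Q U) * theta P e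
   + nu / 2 * theta Q e * theta P e * norm_inf e).

End Propagators.

(* Main.v *)
Require Import Defs.
From mathcomp Require Import ring lra.

(** The idea is to write the update as a perturbation of the linear cyclic
    system and to invert that system.  From [F n = H n + (D n - D n \o P)],
    subtracting the update from the periodicity of [ustar] gives, for the new
    error [e'] and the cyclic operator [C],

      [(C e')_(n+1) = K_n (ustar_n) - K_n (U_n) - r_n],

    where [K_n x = D_n x - D_n (P x)] and [r_n] is the first-order Taylor
    remainder of [H_n] at [ustar_n], in the direction [U'_n - ustar_n]
    ([cyclic_op_error]).

    The remainder is at most [kappa / 2 * |e'|^2] ([norm2_taylor_le]).  The
    function [K_n] vanishes on the range of [P], which is why the complementary
    components appear: along the segment from [U_n] to [ustar_n] its derivative
    in the direction [e_n] is
      [DD_n(x) (Q e_n) + (DD_n(x) - DD_n(P x)) (P e_n)],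
    so that [mu] only meets [Q e_n], and [nu] meets [P e_n] times the distance
    [|Q x|] from [x] to [P x]; since [|Q x| <= |Q U_n| + s |Q e_n|] at the point
    of parameter [s], integration yields the three terms of [rho]
    ([norm2_complement_defect_le]).

    Absence of the eigenvalue 1 makes [C] injective, hence invertible
    ([cyclic_op_ker]), and
      [E' <= Gamma * (kappa / 2 * E'^2 + c)]
    follows, [c] being the bound of the previous paragraph.  One factor [E'] of
    the quadratic term is bounded by [rad], and the smallness condition lets it
    be absorbed in the left-hand side ([le_absorb]).  When [E = 0] all of [c]
    vanishes. *)

Set Implicit Arguments.
Unset Strict Implicit.
Unset Printing Implicit Defensive.

Local Open Scope classical_set_scope.
Local Open Scope ring_scope.

(** * The Euclidean norm and the spectral norm *)

Section EuclideanNorm.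
Variables (R : realType) (d : nat).
Implicit Types (x y : 'rV[R]_d) (A : 'M[R]_d).

Definition dot x y : R := \sum_(i < d) x ord0 i * y ord0 i.

Lemma dot_norm2 x : dot x x = norm2 x ^+ 2.
Proof.
rewrite /norm2 sqr_sqrtr; last by apply: sumr_ge0 => i _; exact: sqr_ge0.
by apply: eq_bigr => i _; rewrite expr2.
Qed.

Lemma dotDl x y z : dot (x + y) z = dot x z + dot y z.
Proof. by rewrite -big_split; apply: eq_bigr => i _; rewrite mxE mulrDl. Qed.

Lemma dotZl a x y : dot (a *: x) y = a * dot x y.
Proof. by rewrite mulr_sumr; apply: eq_bigr => i _; rewrite mxE mulrA. Qed.

Lemma dotC x y : dot x y = dot y x.
Proof. by apply: eq_bigr => i _; rewrite mulrC. Qed.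

Lemma dotBl x y z : dot (x - y) z = dot x z - dot y z.
Proof. by rewrite dotDl -scaleN1r dotZl mulN1r. Qed.

Lemma norm2_ge0 x : 0 <= norm2 x.
Proof. exact: sqrtr_ge0. Qed.

Lemma norm2_eq0 x : norm2 x = 0 -> x = 0.
Proof.
move=> x0; have /eqP : dot x x = 0 by rewrite dot_norm2 x0 expr0n.
rewrite psumr_eq0 => [/allP h|i _]; last by rewrite -expr2 sqr_ge0.
apply/rowP => i; rewrite mxE; apply/eqP.
by move: (h i (mem_index_enum _)); rewrite mulf_eq0 orbb.
Qed.

Lemma norm20 : norm2 (0 : 'rV[R]_d) = 0.
Proof.
by rewrite /norm2 big1 ?sqrtr0// => i _; rewrite mxE expr0n.
Qed.

Lemma norm2_gt0 x : x != 0 -> 0 < norm2 x.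
Proof.
move=> x0; rewrite lt_neqAle norm2_ge0 andbT eq_sym.
by apply: contra x0 => /eqP /norm2_eq0 ->.
Qed.

Lemma norm2Z a x : norm2 (a *: x) = `|a| * norm2 x.
Proof.
rewrite /norm2 -sqrtr_sqr -sqrtrM ?sqr_ge0// mulr_sumr.
by congr Num.sqrt; apply: eq_bigr => i _; rewrite mxE exprMn.
Qed.

Lemma norm2N x : norm2 (- x) = norm2 x.
Proof. by rewrite -scaleN1r norm2Z normrN1 mul1r. Qed.

(** Cauchy-Schwarz, from the nonnegativity of the square norm of
    [|y| x - |x| y]. *)
Lemma dot_le x y : dot x y <= norm2 x * norm2 y.
Proof.
have [->|/norm2_gt0 x0] := eqVneq x 0.
  by rewrite norm20 mul0r -(scale0r (0 : 'rV_d)) dotZl mul0r.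
have [->|/norm2_gt0 y0] := eqVneq y 0.
  by rewrite norm20 mulr0 dotC -(scale0r (0 : 'rV_d)) dotZl mul0r.
have : 0 <= dot (norm2 y *: x - norm2 x *: y) (norm2 y *: x - norm2 x *: y).
  by rewrite dot_norm2 sqr_ge0.
rewrite dotBl !dotZl ![dot _ (_ - _)]dotC !dotBl !dotZl !dot_norm2 (dotC y x).
move: (dot x y) x0 y0 => c; move: (norm2 x) (norm2 y) => a b a0 b0 h.
have : 0 <= 2 * (a * b) * (a * b - c) by nra.
by rewrite pmulr_rge0 ?subr_ge0// !mulr_gt0.
Qed.

Lemma ler_norm2D x y : norm2 (x + y) <= norm2 x + norm2 y.
Proof.
rewrite -(@ler_pXn2r _ 2)// ?nnegrE ?addr_ge0 ?norm2_ge0//.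
rewrite -dot_norm2 dotDl ![dot _ (_ + _)]dotC !dotDl !dot_norm2 (dotC y x).
have := dot_le x y; nra.
Qed.

Lemma le_coord_norm2 x i : `|x ord0 i| <= norm2 x.
Proof.
rewrite -sqrtr_sqr ler_wsqrtr// (bigD1 i)//= lerDl.
by apply: sumr_ge0 => j _; exact: sqr_ge0.
Qed.

Lemma norm2_sum (I : finType) (v : I -> 'rV[R]_d) :
  norm2 (\sum_i v i) <= \sum_i norm2 (v i).
Proof.
apply: (big_ind2 (fun x c => norm2 x <= c)) => //; first by rewrite norm20.
by move=> x a y b xa yb; rewrite (le_trans (ler_norm2D _ _))// lerD.
Qed.

(** The spectral norm is a supremum, and [sup] has a junk value on unbounded
    sets: the content here is that the ratios are bounded, by the sum of the
    norms of the rows of [A]. *)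
Lemma norm2_mulmx A x : norm2 (x *m A) <= spectral_norm A * norm2 x.
Proof.
have [->|x0] := eqVneq x 0; first by rewrite mul0mx norm20 mulr0.
rewrite -ler_pdivrMr ?norm2_gt0//; apply: ub_le_sup; last by exists x.
exists (\sum_i norm2 (row i A)) => _ [w w0 <-].
rewrite ler_pdivrMr ?norm2_gt0// mulmx_sum_row (le_trans (norm2_sum _))//.
rewrite mulr_suml ler_sum// => i _.
by rewrite norm2Z mulrC ler_wpM2l ?norm2_ge0// le_coord_norm2.
Qed.

End EuclideanNorm.

(** * The maximum norm on histories *)

Section HistoryNorm.
Variables (R : realType) (N d : nat).
Implicit Types (w v : history R N d) (S : 'End(history R N d)).

Lemma norm_inf_ge0 w : 0 <= norm_inf w.
Proof. exact: bigmax_ge_id. Qed.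

Lemma le_norm_inf w n : norm2 (w n) <= norm_inf w.
Proof. exact: le_bigmax. Qed.

Lemma norm_inf_le w c :
  0 <= c -> (forall n, norm2 (w n) <= c) -> norm_inf w <= c.
Proof. by move=> c0 wc; apply: bigmax_le. Qed.

Lemma norm_infD w v : norm_inf (w + v) <= norm_inf w + norm_inf v.
Proof.
apply: norm_inf_le => [|n]; first by rewrite addr_ge0 ?norm_inf_ge0.
by rewrite ffunE (le_trans (ler_norm2D _ _))// lerD ?le_norm_inf.
Qed.

Lemma norm_infZ a w : norm_inf (a *: w) <= `|a| * norm_inf w.
Proof.
apply: norm_inf_le => [|n]; first by rewrite mulr_ge0 ?norm_inf_ge0.
by rewrite ffunE norm2Z ler_wpM2l ?le_norm_inf.
Qed.

Lemma norm_inf0 : norm_inf (0 : history R N d) = 0.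
Proof.
apply/le_anti; rewrite norm_inf_ge0 andbT; apply: norm_inf_le => // n.
by rewrite ffunE norm20.
Qed.

Lemma norm_inf_eq0 w : norm_inf w = 0 -> w = 0.
Proof.
move=> w0; apply/ffunP => n; rewrite ffunE; apply: norm2_eq0.
by apply/le_anti; rewrite norm2_ge0 -w0 le_norm_inf.
Qed.

Lemma norm_inf_gt0 w : w != 0 -> 0 < norm_inf w.
Proof.
move=> w0; rewrite lt_neqAle norm_inf_ge0 andbT eq_sym.
by apply: contra w0 => /eqP /norm_inf_eq0 ->.
Qed.

Lemma norm_inf_sum (I : finType) (v : I -> history R N d) :
  norm_inf (\sum_i v i) <= \sum_i norm_inf (v i).
Proof.
apply: (big_ind2 (fun x c => norm_inf x <= c)) => //.
  by rewrite norm_inf0.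
by move=> x a y b xa yb; rewrite (le_trans (norm_infD _ _))// lerD.
Qed.

Definition unit_hist (n : 'I_N) (i : 'I_d) : history R N d :=
  [ffun m => (m == n)%:R *: delta_mx ord0 i].

Lemma hist_sum_unit w :
  w = \sum_n \sum_i w n ord0 i *: unit_hist n i.
Proof.
apply/ffunP => m; rewrite sum_ffunE (bigD1 m)//=.
rewrite [X in _ + X]big1 => [|n nm]; last first.
  rewrite sum_ffunE big1// => i _.
  by rewrite !ffunE eq_sym (negPf nm) scale0r scaler0.
rewrite addr0 sum_ffunE {1}[w m]row_sum_delta; apply: eq_bigr => i _.
by rewrite !ffunE eqxx scale1r.
Qed.

(** As for matrices, the point is boundedness of the ratios, which finite
    dimension provides: [S] is bounded by the sum of the norms of its values on
    the canonical basis. *)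
Lemma norm_inf_app S w : norm_inf (S w) <= opnorm_inf S * norm_inf w.
Proof.
have [->|w0] := eqVneq w 0; first by rewrite linear0 norm_inf0 mulr0.
rewrite -ler_pdivrMr ?norm_inf_gt0//; apply: ub_le_sup; last by exists w.
exists (\sum_n \sum_i norm_inf (S (unit_hist n i))) => _ [v v0 <-].
rewrite ler_pdivrMr ?norm_inf_gt0// {1}[v]hist_sum_unit linear_sum.
rewrite (le_trans (norm_inf_sum _))// mulr_suml ler_sum// => n _.
rewrite linear_sum (le_trans (norm_inf_sum _))// mulr_suml ler_sum// => i _.
rewrite linearZ (le_trans (norm_infZ _ _))// mulrC ler_wpM2l ?norm_inf_ge0//.
by rewrite (le_trans (le_coord_norm2 _ _))// le_norm_inf.
Qed.

Lemma opnorm_inf_ge0 S : 0 <= opnorm_inf S.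
Proof.
have [[w w0]|w0] := pselect (exists w : history R N d, w != 0).
  rewrite -(pmulr_lge0 _ (norm_inf_gt0 w0)).
  exact: le_trans (norm_inf_ge0 _) (norm_inf_app S w).
(* If every history is zero, the supremum is that of the empty set. *)
rewrite /opnorm_inf (_ : [set w : history R N d | w != 0] = set0).
  by rewrite image_set0 sup0.
by apply/seteqP; split => // w /= ww0; case: w0; exists w.
Qed.

End HistoryNorm.

(** * Mean value estimates *)

Section MeanValue.
Variables (R : realType) (d : nat).
Implicit Types (g : R -> 'rV[R]_d) (h : 'rV[R]_d -> 'rV[R]_d) (x v : 'rV[R]_d).

Lemma is_derive_dot g (dg v : 'rV[R]_d) (s : R) :
  is_derive s 1 g dg -> is_derive s 1 (fun t => dot (g t) v) (dot dg v).
Proof.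
move=> [dg1 dg2].
rewrite (_ : (fun t => dot (g t) v) =
             \sum_(i < d) (v ord0 i \*: (fun t => g t ord0 i))); last first.
  by apply/funext => t; rewrite fct_sumE; apply: eq_bigr => i _; rewrite mulrC.
rewrite (_ : dot dg v = \sum_(i < d) v ord0 i *: dg ord0 i); last first.
  by apply: eq_bigr => i _; rewrite mulrC.
apply: is_derive_sum => i; apply: is_deriveZ; split.
  by move/derivable_mxP: dg1; exact.
by rewrite -dg2 derive_mx// mxE.
Qed.

Lemma is_derive_line h x v (s : R) :
  differentiable h (x + s *: v) ->
  is_derive s 1 (fun t => h (x + t *: v)) (v *m 'J h (x + s *: v)).
Proof.
move=> dh; pose l := fun t : R => x + t *: v.
have dl : is_diff s l ( *:%R^~ v).
  rewrite (_ : l = cst x + ( *:%R^~ v)); last exact/funext.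
  rewrite -[X in is_diff _ _ X]add0r.
  exact: is_diffD (is_diff_cst _ _) (is_diff_scalel _ _).
have dhl : differentiable (h \o l) s by apply: differentiable_comp.
split; first exact/derivable1_diffP.
rewrite -[LHS]/('D_1 (h \o l) s) deriveE// diff_comp//= diff_val scale1r.
by rewrite -deriveE// deriveEjacobian.
Qed.

(** Plays the role of integrating the bound [a + b s] over [[0, 1]], without
    integrals of vector-valued functions: for [v = g 1 - g 0], the scalar
    function [<g s, v> - |v| (a s + b s^2 / 2)] is nonincreasing by
    Cauchy-Schwarz, and comparing its end values gives
    [|v|^2 <= |v| (a + b / 2)]. *)
Lemma mean_value_norm2 g (dg : R -> 'rV[R]_d) (a b : R) :
  (forall s : R, 0 <= s <= 1 -> is_derive s 1 g (dg s)) ->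
  (forall s : R, 0 <= s <= 1 -> norm2 (dg s) <= a + b * s) ->
  norm2 (g 1 - g 0) <= a + b / 2.
Proof.
move=> dgP dg_le; set v := g 1 - g 0.
pose q := fun s : R => norm2 v * (a * s + b / 2 * s ^+ 2).
pose phi := fun s : R => dot (g s) v - q s.
have dq (s : R) : is_derive s 1 q (norm2 v * (a + b * s)).
  (* A polynomial, so that its derivative is computed formally. *)
  pose p : {poly R} := (norm2 v)%:P * (a%:P * 'X + (b / 2)%:P * 'X ^+ 2).
  have -> : q = horner p.
    by apply/funext => t; rewrite /q /p !hornerE.
  apply: (is_derive_eq (is_derive_poly p s)).
  by rewrite /p !poly.derivE !hornerE /=; field.
have dphi (s : R) : 0 <= s <= 1 ->
    is_derive s 1 phi (dot (dg s) v - norm2 v * (a + b * s)).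
  by move=> s01; apply: is_deriveB; exact: is_derive_dot (dgP _ s01).
have phi01 : phi 1 <= phi 0.
  apply: (@ler0_derive1_le_cc _ phi 0 1); rewrite ?in_itv/= ?lexx ?ler01//.
  - move=> s; rewrite in_itv/= => /andP[s0 s1].
    have [] // := dphi s; by rewrite !ltW.
  - move=> s; rewrite in_itv/= => /andP[s0 s1].
    have s01 : 0 <= s <= 1 by rewrite !ltW.
    rewrite derive1E (@derive_val _ _ _ _ _ _ _ (dphi _ s01)) subr_le0.
    by rewrite (le_trans (dot_le _ _))// mulrC ler_wpM2l ?norm2_ge0// dg_le.
  - apply: derivable_within_continuous => s; rewrite in_itv/= => s01.
    by have [] := dphi s s01.
have ab0 : 0 <= a + b / 2.
  have /dg_le : 0 <= (2^-1 : R) <= 1 by apply/andP; split; lra.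
  by apply: le_trans; exact: norm2_ge0.
have : norm2 v * norm2 v <= norm2 v * (a + b / 2).
  rewrite -expr2 -dot_norm2 {1}/v dotBl.
  by move: phi01; rewrite /phi /q; lra.
have := norm2_ge0 v; rewrite le_eqVlt => /predU1P[<- //|v0].
by rewrite ler_pM2l.
Qed.

(** The remainder has derivative [v ('J h (x + s v) - 'J h x)], of norm at most
    [kappa s |v|^2]: the factor 1/2 is the mean of [s]. *)
Lemma norm2_taylor_le h x v (kappa : R) :
  (forall s : R, 0 <= s <= 1 -> differentiable h (x + s *: v)) ->
  (forall s : R, 0 <= s <= 1 ->
    spectral_norm ('J h (x + s *: v) - 'J h x) <= kappa * norm2 (s *: v)) ->
  norm2 (h (x + v) - h x - v *m 'J h x) <= kappa / 2 * norm2 v ^+ 2.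
Proof.
move=> dh lipJ.
pose g := fun s : R => h (x + s *: v) - s *: (v *m 'J h x).
have -> : h (x + v) - h x - v *m 'J h x = g 1 - g 0.
  by rewrite /g !scale1r !scale0r addr0 subr0 addrAC.
have -> : kappa / 2 * norm2 v ^+ 2 = 0 + kappa * norm2 v ^+ 2 / 2 by ring.
pose dg := fun s : R => v *m 'J h (x + s *: v) - v *m 'J h x.
apply: (@mean_value_norm2 _ dg) => s s01.
  apply: is_deriveB; first exact: is_derive_line (dh _ s01).
  rewrite -[X in is_derive _ _ _ X]scale1r.
  have ds := is_diff_scalel s (v *m 'J h x).
  split; first exact/derivable1_diffP.
  by rewrite deriveE// diff_val.
rewrite /dg -mulmxBr add0r (le_trans (norm2_mulmx _ _))//.
rewrite (le_trans (ler_wpM2r (norm2_ge0 _) (lipJ _ s01)))//.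
rewrite norm2Z ger0_norm; last by case/andP: s01.
lra.
Qed.

(** The increment of [y |-> h y - h (y P)] from [x] to [x + v].  Splitting
    [v = v Q + v P], its derivative along the segment is the Jacobian applied to
    [v Q], plus a difference of Jacobians at points [|y Q|] apart applied to
    [v P]. *)
Lemma norm2_complement_defect_le h x v (P : 'M[R]_d) (mu nu : R) :
  0 <= nu ->
  (forall s : R, 0 <= s <= 1 -> differentiable h (x + s *: v)) ->
  (forall s : R, 0 <= s <= 1 -> differentiable h ((x + s *: v) *m P)) ->
  (forall s : R, 0 <= s <= 1 -> spectral_norm ('J h (x + s *: v)) <= mu) ->
  (forall s : R, 0 <= s <= 1 ->
    spectral_norm ('J h (x + s *: v) - 'J h ((x + s *: v) *m P)) <=
    nu * norm2 ((x + s *: v) - (x + s *: v) *m P)) ->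
  norm2 ((h (x + v) - h ((x + v) *m P)) - (h x - h (x *m P))) <=
  mu * norm2 (v *m (1%:M - P)) + nu * norm2 (x *m (1%:M - P)) * norm2 (v *m P)
    + nu / 2 * norm2 (v *m (1%:M - P)) * norm2 (v *m P).
Proof.
set Q := 1%:M - P; move=> nu0 dh dhP muJ nuJ.
have PE s : (x + s *: v) *m P = x *m P + s *: (v *m P).
  by rewrite mulmxDl scalemxAl.
pose g := fun s : R => h (x + s *: v) - h (x *m P + s *: (v *m P)).
have -> : h (x + v) - h ((x + v) *m P) - (h x - h (x *m P)) = g 1 - g 0.
  by rewrite /g !scale1r !scale0r !addr0 mulmxDl.
have -> : nu / 2 * norm2 (v *m Q) * norm2 (v *m P) =
  nu * norm2 (v *m Q) * norm2 (v *m P) / 2 by ring.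
pose dg := fun s : R => v *m 'J h (x + s *: v)
  - (v *m P) *m 'J h (x *m P + s *: (v *m P)).
apply: (@mean_value_norm2 _ dg) => s s01.
  apply: is_deriveB; first exact: is_derive_line (dh _ s01).
  by apply: is_derive_line; rewrite -PE; exact: dhP.
have -> : dg s = v *m Q *m 'J h (x + s *: v) +
    v *m P *m ('J h (x + s *: v) - 'J h ((x + s *: v) *m P)).
  by rewrite PE /dg mulmxBr mulmxBr mulmxBl mulmx1 addrA subrK.
rewrite -addrA (le_trans (ler_norm2D _ _))// lerD//.
  by rewrite (le_trans (norm2_mulmx _ _))// ler_wpM2r ?norm2_ge0 ?muJ.
rewrite (le_trans (norm2_mulmx _ _))//.
rewrite (le_trans (ler_wpM2r (norm2_ge0 _) (nuJ _ s01)))//.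
have -> : (x + s *: v) - (x + s *: v) *m P = x *m Q + s *: (v *m Q).
  by rewrite -[X in X - _]mulmx1 -mulmxBr mulmxDl scalemxAl.
have -> : nu * norm2 (x *m Q) * norm2 (v *m P) +
    nu * norm2 (v *m Q) * norm2 (v *m P) * s =
    nu * (norm2 (x *m Q) + s * norm2 (v *m Q)) * norm2 (v *m P) by ring.
rewrite ler_wpM2r ?norm2_ge0// ler_wpM2l// (le_trans (ler_norm2D _ _))//.
by rewrite norm2Z ger0_norm//; case/andP: s01.
Qed.

End MeanValue.

(** * Invertibility of the cyclic operator *)

(** The product is taken in the ring of square matrices, where it is convertible
    with the iterated [mulmx] of the monodromy matrix and obeys the monoid
    laws. *)
Lemma cyclic_orbit (R : realType) (N d : nat) (J : 'I_N.+1 -> 'M[R]_d)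
    (w : history R N.+1 d) :
  (forall n, w (ordS n) = w n *m J n) ->
  w ord0 *m (\prod_(n < N.+1) J n) = w ord0.
Proof.
move=> wJ; pose A k := J (inord k).
have orbit k : (k < N.+1)%N ->
    w (inord k) = w ord0 *m \prod_(0 <= i < k) A i.
  elim: k => [|k IH] kN.
    by rewrite big_geq// mulmx1; congr (w _); apply/val_inj; rewrite /= inordK.
  rewrite big_nat_recr//= -mulmxE mulmxA -IH ?(ltnW kN)// -wJ; congr (w _).
  by apply/val_inj; rewrite /= !inordK ?(ltnW kN)// modn_small.
have -> : \prod_(n < N.+1) J n = \prod_(0 <= i < N.+1) A i.
  by rewrite big_mkord; apply: eq_bigr => i _; rewrite /A inord_val.
rewrite big_nat_recr//= -mulmxE mulmxA -orbit// -wJ; congr (w _).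
by apply/val_inj; rewrite /= inordK// modnn.
Qed.

(** A kernel element is an orbit of the linearized propagators that closes up
    after one period, so that its value at 0 is fixed by the monodromy matrix:
    it is zero, and the rest of the orbit with it. *)
Lemma cyclic_op_ker (R : realType) (N d : nat)
    (F G : 'I_N -> 'rV[R]_d -> 'rV[R]_d) (P : 'M[R]_d) (u : history R N d) :
  ~~ eigenvalue (monodromy F G P u) 1 -> lker (cyclic_op F G P u) == 0%VS.
Proof.
move=> noev; apply/lker0P => w1 w2 /eqP; rewrite -subr_eq0 -linearB /= => /eqP.
move: (w1 - w2) (subr_eq0 w1 w2) => w wE Cw0; apply/eqP; rewrite -wE.
clear w1 w2 wE.
case: N => [|N] in F G u w noev Cw0 *; first by apply/eqP/ffunP => -[].
have wJ n : w (ordS n) = w n *m 'J (Hprop F G P n) (u n).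
  by apply/eqP; rewrite -subr_eq0 -cyclic_opE Cw0 ffunE.
have w00 : w ord0 = 0.
  apply: contraNeq noev => w00; apply/eigenvalueP; exists (w ord0) => //.
  by rewrite scale1r; exact: cyclic_orbit.
have w0 k : (k < N.+1)%N -> w (inord k) = 0.
  elim: k => [|k IH] kN.
    by rewrite -w00; congr (w _); apply/val_inj; rewrite /= inordK.
  rewrite (_ : inord k.+1 = ordS (inord k)) ?wJ ?IH ?mul0mx// ?(ltnW kN)//.
  by apply/val_inj; rewrite /= !inordK ?(ltnW kN)// modn_small.
by apply/eqP/ffunP => n; rewrite ffunE -(inord_val n) w0.
Qed.

(** * The error equation and the contraction estimate *)

Lemma convex_set_segment (R : realType) (d : nat) (B : set 'rV[R]_d)
    (x y : 'rV[R]_d) (s : R) :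
  convex_set B -> B x -> B y -> 0 <= s <= 1 -> B (x + s *: (y - x)).
Proof.
move=> cB Bx By /andP[s0 s1].
have := cB y x (Itv01 s0 s1) (mem_set By) (mem_set Bx).
rewrite inE; congr B; rewrite /conv /= /unstable.onem scalerBl scale1r scalerBr.
by rewrite addrCA.
Qed.

Lemma C1_near_differentiable (R : realType) (d : nat) (B : set 'rV[R]_d) h x :
  C1_near B h -> B x -> differentiable h x.
Proof. by case=> O [_ BO dh _] /BO; exact: dh. Qed.

(** The error of the update solves the linearized cyclic system, up to a term
    that only sees the discrepancy off the range of [P] and a Taylor
    remainder. *)
Lemma cyclic_op_error (R : realType) (N d : nat)
    (F G : 'I_N -> 'rV[R]_d -> 'rV[R]_d) (P : 'M[R]_d)
    (ustar U U' : history R N d) n :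
  let D := discrepancy F G in
  fine_periodic F ustar -> PP_PC_update F G P U U' ->
  cyclic_op F G P ustar (ustar - U') (ordS n) =
  (D n (ustar n) - D n (ustar n *m P)) - (D n (U n) - D n (U n *m P)) -
  (Hprop F G P n (U' n) - Hprop F G P n (ustar n)
     - (U' n - ustar n) *m 'J (Hprop F G P n) (ustar n)).
Proof.
move=> D per upd; rewrite cyclic_opE !ffunE per upd.
have FE x : F n x = Hprop F G P n x + (D n x - D n (x *m P)).
  by rewrite /Hprop /D /discrepancy; apply/rowP => i; rewrite !mxE; ring.
rewrite !FE -(opprB (U' n)) mulNmx.
by apply/rowP => i; rewrite !mxE; ring.
Qed.

(** One factor of [E ^+ 2] is bounded by [rad], which leaves a multiple of [E]
    smaller than [E] itself. *)
Lemma le_absorb (R : realFieldType) (Gamma kappa rad E c : R) :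
  0 <= Gamma -> 0 <= kappa -> 0 <= E -> E <= rad ->
  2^-1 * Gamma * kappa * rad < 1 ->
  E <= Gamma * (kappa / 2 * E ^+ 2 + c) ->
  E <= Gamma / (1 - 2^-1 * Gamma * kappa * rad) * c.
Proof.
move=> G0 k0 E0 Erad small EE.
rewrite mulrAC ler_pdivlMr ?subr_gt0//.
have : Gamma * kappa * E * E <= Gamma * kappa * E * rad.
  by rewrite ler_wpM2l// !mulr_ge0.
lra.
Qed.

Theorem lemma4p1 (R : realType) (d N : nat) (T : R)
    (Omega : set 'rV[R]_d) (f : 'rV[R]_d -> R -> 'rV[R]_d)
    (F G : 'I_N -> 'rV[R]_d -> 'rV[R]_d)
    (ustar U U' : history R N d) (P : 'M[R]_d)
    (B : set 'rV[R]_d) (mu nu kappa rad : R) :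
  let e := ustar - U in
  let e' := ustar - U' in
  let D := discrepancy F G in
  let H := Hprop F G P in
  let Gamma := Gamma_hat F G P ustar in
  0 < T -> (0 < N)%N ->
  open Omega -> periodic_rhs T Omega f ->
  (forall n, [/\ Omega (ustar n), Omega (U n) & Omega (U' n)]) ->
  fine_periodic F ustar ->
  orth_proj P ->
  PP_PC_update F G P U U' ->
  convex_set B ->
  (forall n (s : R), 0 <= s <= 1 ->
     B (U n + s *: e n) /\ B ((U n + s *: e n) *m P)) ->
  (forall n, B (ustar n) /\ B (U' n)) ->
  (forall n, C1_near B (H n)) ->
  ~~ eigenvalue (monodromy F G P ustar) 1 ->
  (forall n, C1_near B (D n)) ->
  0 <= mu -> 0 <= nu -> 0 <= kappa ->
  (forall n x, B x -> spectral_norm ('J (D n) x) <= mu) ->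
  (forall n x y, B x -> B y ->
     spectral_norm ('J (D n) x - 'J (D n) y) <= nu * norm2 (x - y)) ->
  (forall n x y, B x -> B y ->
     spectral_norm ('J (H n) x - 'J (H n) y) <= kappa * norm2 (x - y)) ->
  0 < rad ->
  norm_inf e' <= rad ->
  2^-1 * Gamma * kappa * rad < 1 ->
  (norm_inf e = 0 -> norm_inf e' = 0) /\
  (0 < norm_inf e ->
     norm_inf e' <= contraction_rho Gamma mu nu kappa rad P U e * norm_inf e).
Proof.
move=> e e' D H Gamma _ _ _ _ _ per _ upd cB segB endB C1H noev C1D.
move=> mu0 nu0 kappa0 muD nuD kappaH _ e'rad small.
pose Q := 1%:M - P.
pose q := norm_inf (act_hist Q e); pose p := norm_inf (act_hist P e).
pose uq := norm_inf (act_hist Q U).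
have q0 : 0 <= q := norm_inf_ge0 _.
have p0 : 0 <= p := norm_inf_ge0 _.
have uq0 : 0 <= uq := norm_inf_ge0 _.
pose c := mu * q + nu * uq * p + nu / 2 * q * p.
have le_act A (w : history R N d) n :
    norm2 (w n *m A) <= norm_inf (act_hist A w).
  by have := le_norm_inf (act_hist A w) n; rewrite ffunE.
have c0 : 0 <= c by rewrite /c !addr_ge0 ?mulr_ge0 ?divr_ge0.
have defect n : norm2 ((D n (ustar n) - D n (ustar n *m P)) -
    (D n (U n) - D n (U n *m P))) <= c.
  have uE : ustar n = U n + e n by rewrite !ffunE addrCA subrr addr0.
  rewrite {1 2}uE.
  have /le_trans-> // : norm2 (D n (U n + e n) - D n ((U n + e n) *m P)
      - (D n (U n) - D n (U n *m P))) <=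
      mu * norm2 (e n *m Q) + nu * norm2 (U n *m Q) * norm2 (e n *m P)
      + nu / 2 * norm2 (e n *m Q) * norm2 (e n *m P).
    have defect_le :=
      @norm2_complement_defect_le _ _ (D n) (U n) (e n) P mu nu nu0.
    apply: defect_le => s s01; have [Bx BxP] := segB n s s01.
    - exact: C1_near_differentiable (C1D n) Bx.
    - exact: C1_near_differentiable (C1D n) BxP.
    - exact: muD.
    - exact: nuD.
  rewrite !lerD// ?ler_wpM2l ?le_act//.
    by rewrite ler_pM ?mulr_ge0 ?norm2_ge0 ?ler_wpM2l ?le_act.
  by rewrite ler_pM ?mulr_ge0 ?divr_ge0 ?norm2_ge0 ?ler_wpM2l ?divr_ge0 ?le_act.
have taylor n : norm2 (H n (U' n) - H n (ustar n)
     - (U' n - ustar n) *m 'J (H n) (ustar n)) <= kappa / 2 * norm_inf e' ^+ 2.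
  have [Bu BU'] := endB n.
  have uE : U' n = ustar n + (U' n - ustar n) by rewrite addrC subrK.
  have segB' s : 0 <= s <= 1 -> B (ustar n + s *: (U' n - ustar n)).
    exact: convex_set_segment.
  rewrite {1}uE; apply: le_trans (norm2_taylor_le _ _) _.
  - by move=> s /segB'; exact: C1_near_differentiable.
  - move=> s /segB' Bs; rewrite (le_trans (kappaH _ _ _ Bs Bu))//.
    by rewrite addrAC subrr add0r.
  - rewrite ler_wpM2l ?divr_ge0// ler_pXn2r ?nnegrE ?norm2_ge0 ?norm_inf_ge0//.
    by rewrite -norm2N opprB; have := le_norm_inf e' n; rewrite !ffunE.
have step : norm_inf e' <= Gamma * (kappa / 2 * norm_inf e' ^+ 2 + c).
  have Ce' : norm_inf (cyclic_op F G P ustar e') <=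
      kappa / 2 * norm_inf e' ^+ 2 + c.
    apply: norm_inf_le => [|m].
      by rewrite addr_ge0// mulr_ge0 ?sqr_ge0 ?divr_ge0.
    rewrite -(ord_predK m) (cyclic_op_error _ per upd).
    rewrite (le_trans (ler_norm2D _ _))//.
    by rewrite norm2N addrC lerD.
  rewrite -{1}[e'](lker0_lfunK (cyclic_op_ker noev)).
  by rewrite (le_trans (norm_inf_app _ _))// ler_wpM2l ?opnorm_inf_ge0.
have bound : norm_inf e' <= Gamma / (1 - 2^-1 * Gamma * kappa * rad) * c.
  by apply: le_absorb step; rewrite ?opnorm_inf_ge0 ?norm_inf_ge0.
split=> [/norm_inf_eq0 e0|E0].
  have act0 A : act_hist A e = 0 by apply/ffunP => n; rewrite e0 !ffunE mul0mx.
  apply/le_anti; rewrite norm_inf_ge0 andbT (le_trans bound)//.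
  by rewrite /c /q /p !act0 norm_inf0 !mulr0 !addr0 mulr0.
suff -> : contraction_rho Gamma mu nu kappa rad P U e * norm_inf e =
    Gamma / (1 - 2^-1 * Gamma * kappa * rad) * c by [].
rewrite /contraction_rho /theta -/Q -/q -/p -/uq -[LHS]mulrA; congr (_ * _).
by rewrite /c; field; rewrite gt_eqF.
Qed.
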